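(* Let $(M,g)$ be a general relativistic perfect fluid spacetime with isotropic pressure $p$, energy-density $\sigma$, cosmological constant $\lambda$, gravitational constant $k$ and velocity vector field $\xi$ with $g$-dual $1$-form $\eta$, and let $(g,\xi,a,b)$ be an $\eta$-Ricci soliton in $M$, i.e. $a,b$ are real constants with $\mathcal{L}_{\xi}g+2S+2a g+2b\,\eta\otimes \eta=0$. Then $$a=-\lambda-\frac{k(\sigma-p)}{2}-\frac{\mathrm{div}(\xi)}{3},\qquad b=-k(\sigma+p)-\frac{\mathrm{div}(\xi)}{3}.$$
   Context: A perfect fluid spacetime here is a $4$-dimensional smooth manifold $M$ with a Lorentzian metric $g$ (one negative sign in the signature), a smooth velocity vector field $\xi$ with $g(\xi,\xi)=-1$ and dual $1$-form $\eta(X)=g(X,\xi)$, and smooth functions $p$ (pressure) and $\sigma$ (energy-density), such that Einstein's equations $kT=S+(\lambda-\frac r2)g$ hold with $T=pg+(\sigma+p)\eta\otimes\eta$; equivalently $$S(X,Y)=\left(\lambda+\frac{k(\sigma-p)}{2}\right)g(X,Y)+k(\sigma+p)\eta(X)\eta(Y)$$ for all vector fields $X,Y$. Here $S$ is the Ricci tensor, $r$ the scalar curvature, $\lambda$ a real constant and $k$ the gravitational constant. $\mathcal{L}_\xi g$ is the Lie derivative, $\mathrm{div}(\xi)$ the trace of $X\mapsto\nabla_X\xi$. *)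

(* Defs.v *)
From mathcomp Require Import all_boot all_order all_algebra.
From mathcomp Require Import all_classical all_reals all_analysis.
From mathcomp Require Import ring.

Set Implicit Arguments.
Unset Strict Implicit.
Unset Printing Implicit Defensive.

Import Order.TTheory GRing.Theory Num.Theory.
Import numFieldNormedType.Exports.

Local Open Scope classical_set_scope.
Local Open Scope ring_scope.

(* Geometry on a manifold M is done in the charts of its atlas.  A point of a
   chart is a u : 'rV_n, a tangent vector at u is a row vector of components
   with respect to the coordinate frame 'e_0, ..., 'e_(n-1), and a tensor field
   on M is a family of component functions, one for each chart, related by the
   transformation law on overlaps.  'D_v f u is the derivative of f at u along
   v, so that 'D_v phi u is the push-forward of v by phi at u. *)

Fixpoint Ck_on (R : realType) (n : nat) (W : normedModType R) (k : nat)
    (U : set 'rV[R]_n) (f : 'rV[R]_n -> W) : Prop :=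
  if k is k'.+1 then
    (forall u, U u -> differentiable f u) /\
    (forall v, Ck_on k' U (fun u => 'D_v f u))
  else forall u, U u -> {for u, continuous f}.

(* Only used for open U. *)
Definition smooth_on (R : realType) (n : nat) (W : normedModType R)
    (U : set 'rV[R]_n) (f : 'rV[R]_n -> W) : Prop :=
  forall k, Ck_on k U f.

(* cmap and cinv are only meaningful on cdom and on its image crange. *)
Record chart (R : realType) (n : nat) (T : topologicalType) := Chart {
  cdom : set T;
  cmap : T -> 'rV[R]_n;
  cinv : 'rV[R]_n -> T }.

Definition crange (R : realType) (n : nat) (T : topologicalType)
    (c : chart R n T) : set 'rV[R]_n := cmap c @` cdom c.

Definition is_chart (R : realType) (n : nat) (T : topologicalType)
    (c : chart R n T) : Prop :=
  [/\ open (cdom c), open (crange c),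
      forall x, cdom c x -> cinv c (cmap c x) = x,
      {within cdom c, continuous (cmap c)} &
      {within crange c, continuous (cinv c)}].

Definition overlap (R : realType) (n : nat) (T : topologicalType)
    (c c' : chart R n T) : set 'rV[R]_n := cmap c @` (cdom c `&` cdom c').

Definition transition (R : realType) (n : nat) (T : topologicalType)
    (c c' : chart R n T) : 'rV[R]_n -> 'rV[R]_n := cmap c' \o cinv c.

Record manifold (R : realType) (n : nat) := Manifold {
  mcarrier :> topologicalType;
  mindex : Type;
  mchart : mindex -> chart R n mcarrier;
  manifold_hausdorff : hausdorff_space mcarrier;
  manifold_second_countable : @second_countable mcarrier;
  manifold_chart : forall i, is_chart (mchart i);
  manifold_cover : forall x, exists i, cdom (mchart i) x;
  manifold_smooth : forall i j, smooth_on
    (overlap (mchart i) (mchart j)) (transition (mchart i) (mchart j)) }.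

Definition smooth_function (R : realType) (n : nat) (M : manifold R n)
    (f : M -> R) : Prop :=
  forall i : mindex M,
    smooth_on (crange (mchart i)) (fun u => f (cinv (mchart i) u)).

Record vector_field (R : realType) (n : nat) (M : manifold R n) := VectorField {
  vfcomp :> mindex M -> 'rV[R]_n -> 'rV[R]_n;
  vector_field_smooth : forall i, smooth_on (crange (mchart i)) (vfcomp i);
  vector_field_law : forall i j u, overlap (mchart i) (mchart j) u ->
    let phi := transition (mchart i) (mchart j) in
    vfcomp j (phi u) = 'D_(vfcomp i u) phi u }.

Definition bilin (R : realType) (n : nat) (B : 'M[R]_n) (v w : 'rV[R]_n) : R :=
  (v *m B *m w^T) 0 0.

Definition minkowski (R : realType) (n : nat) : 'M[R]_n :=
  diag_mx (\row_(i < n) (if i == 0%N :> nat then -1 else 1)).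

Definition lorentzian (R : realType) (n : nat) (B : 'M[R]_n) : Prop :=
  B^T = B /\ exists2 P : 'M[R]_n, P \in unitmx & P *m B *m P^T = minkowski R n.

Record lorentz_metric (R : realType) (n : nat) (M : manifold R n) :=
  LorentzMetric {
  mcomp :> mindex M -> 'rV[R]_n -> 'M[R]_n;
  metric_smooth : forall i, smooth_on (crange (mchart i)) (mcomp i);
  metric_lorentzian : forall i u,
    crange (mchart i) u -> lorentzian (mcomp i u);
  metric_law : forall i j u v w, overlap (mchart i) (mchart j) u ->
    let phi := transition (mchart i) (mchart j) in
    bilin (mcomp j (phi u)) ('D_v phi u) ('D_w phi u) = bilin (mcomp i u) v w }.

(* In the next section, G holds the components of the metric in one chart,
   and X, Y, Z, xi are the component functions of vector fields defined on that
   chart. *)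

Section LocalGeometry.
Context (R : realType) (n : nat).
Local Notation E := 'rV[R]_n.
Implicit Types (G : E -> 'M[R]_n) (X Y Z xi : E -> E) (u v w : E).

Definition inner G X Y u : R := bilin (G u) (X u) (Y u).

Definition bracket X Y u : E := 'D_(X u) Y u - 'D_(Y u) X u.

Definition christoffel G u (k i j : 'I_n) : R :=
  2^-1 * \sum_l invmx (G u) k l *
    ('D_('e_i) (fun u' => G u' j l) u + 'D_('e_j) (fun u' => G u' i l) u
     - 'D_('e_l) (fun u' => G u' i j) u).

(* The Levi-Civita connection, as characterized by nabla_torsion_free and
   nabla_metric below. *)
Definition nabla G X Y u : E :=
  'D_(X u) Y u
  + \row_k \sum_i \sum_j X u 0 i * Y u 0 j * christoffel G u k i j.

Definition curvature G X Y Z u : E :=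
  nabla G X (nabla G Y Z) u - nabla G Y (nabla G X Z) u
  - nabla G (bracket X Y) Z u.

(* Trace of V |-> curvature G V Y Z at u.  This map is tensorial in V, so it
   induces an endomorphism of the tangent space at u, computed by extending a
   tangent vector v to the field cst v of constant components.  The same remark
   applies to scalar_curvature and divergence. *)
Definition ricci G Y Z u : R :=
  \tr (lin1_mx (fun v => curvature G (cst v) Y Z u)).

Definition scalar_curvature G u : R :=
  \sum_i \sum_j invmx (G u) i j * ricci G (cst 'e_i) (cst 'e_j) u.

Definition divergence G xi u : R :=
  \tr (lin1_mx (fun v => nabla G (cst v) xi u)).

Definition lie_metric G xi X Y u : R :=
  'D_(xi u) (inner G X Y) u
  - inner G (bracket xi X) Y u - inner G X (bracket xi Y) u.

Lemma nabla_torsion_free G X Y u :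
  (\forall u' \near u, (G u')^T = G u') ->
  nabla G X Y u - nabla G Y X u = bracket X Y u.
Proof.
move=> Gs.
have chrC k i j : christoffel G u k i j = christoffel G u k j i.
  congr (_ * _); apply: eq_bigr => l _; congr (_ * (_ - _)); first by rewrite addrC.
  apply: near_eq_derive; near=> u'.
  have /(congr1 (fun B : 'M[R]_n => B j i)) : (G u')^T = G u' by near: u'.
  by rewrite mxE.
rewrite /nabla /bracket opprD addrACA; set r1 := \row_k _; set r2 := \row_k _.
suff -> : r1 = r2 by rewrite subrr addr0.
apply/rowP => k; rewrite !mxE exchange_big; apply: eq_bigr => i _.
by apply: eq_bigr => j _; rewrite chrC [X u 0 _ * _]mulrC.
Unshelve. all: by end_near. Qed.

Lemma bilinE (B : 'M[R]_n) v w :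
  bilin B v w = \sum_i \sum_j v 0 i * B i j * w 0 j.
Proof.
rewrite /bilin mxE exchange_big; apply: eq_bigr => j _.
by rewrite !mxE mulr_suml.
Qed.

Lemma christoffel_lower G u i j m :
  (G u)^T = G u -> G u \in unitmx ->
  \sum_k christoffel G u k i j * G u k m
  = 2^-1 * ('D_('e_i) (fun u' => G u' j m) u + 'D_('e_j) (fun u' => G u' i m) u
            - 'D_('e_m) (fun u' => G u' i j) u).
Proof.
move=> Gs Gu.
pose d l := 'D_('e_i) (fun u' => G u' j l) u + 'D_('e_j) (fun u' => G u' i l) u
  - 'D_('e_l) (fun u' => G u' i j) u.
have invG l : \sum_k invmx (G u) k l * G u k m = (l == m)%:R.
  have /(congr1 (fun B : 'M[R]_n => B l m)) : (invmx (G u))^T *m G u = 1%:M.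
    by rewrite trmx_inv Gs mulVmx.
  by rewrite !mxE => <-; apply: eq_bigr => k _; rewrite mxE.
transitivity (2^-1 * \sum_l d l * \sum_k invmx (G u) k l * G u k m).
  under eq_bigr do rewrite /christoffel -mulrA mulr_suml.
  rewrite -mulr_sumr exchange_big; congr (_ * _); apply: eq_bigr => l _.
  by rewrite mulr_sumr; apply: eq_bigr => k _; rewrite -/(d l); ring.
under eq_bigr do rewrite invG.
rewrite (bigD1 m) //= eqxx mulr1 big1 ?addr0 // => l /negbTE ->.
by rewrite mulr0.
Qed.

Lemma nabla_metric G X Y Z u :
  (\forall u' \near u, (G u')^T = G u') -> G u \in unitmx ->
  differentiable G u -> differentiable Y u -> differentiable Z u ->
  'D_(X u) (inner G Y Z) u
    = inner G (nabla G X Y) Z u + inner G Y (nabla G X Z) u.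
Proof.
move=> Gs Gu dG dY dZ; have Gsu : (G u)^T = G u by exact: nbhs_singleton Gs.
have dGs l i j :
    'D_('e_l) (fun u' => G u' j i) u = 'D_('e_l) (fun u' => G u' i j) u.
  apply: near_eq_derive; near=> u'.
  have /(congr1 (fun B : 'M[R]_n => B i j)) : (G u')^T = G u' by near: u'.
  by rewrite mxE.
have dGc i j : differentiable (fun u' => G u' i j) u.
  exact: (differentiable_comp dG (differentiable_coord (G u) i j)).
have dYc i : differentiable (fun u' => Y u' 0 i) u.
  exact: (differentiable_comp dY (differentiable_coord (Y u) 0 i)).
have dZc i : differentiable (fun u' => Z u' 0 i) u.
  exact: (differentiable_comp dZ (differentiable_coord (Z u) 0 i)).
have DG i j : 'D_(X u) (fun u' => G u' i j) u
    = \sum_l X u 0 l * 'D_('e_l) (fun u' => G u' i j) u.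
  rewrite deriveE // [X in 'd _ _ X]row_sum_delta linear_sum.
  by apply: eq_bigr => l _; rewrite linearZ /= deriveE.
have DY i : ('D_(X u) Y u) 0 i = 'D_(X u) (fun u' => Y u' 0 i) u.
  by rewrite derive_mx ?mxE //; exact: diff_derivable.
have DZ i : ('D_(X u) Z u) 0 i = 'D_(X u) (fun u' => Z u' 0 i) u.
  by rewrite derive_mx ?mxE //; exact: diff_derivable.
have -> : inner G Y Z = \sum_i \sum_j
    ((fun u' => Y u' 0 i) * (fun u' => G u' i j) * (fun u' => Z u' 0 j)).
  apply/funext => u'; rewrite /inner bilinE fct_sumE; apply: eq_bigr => i _.
  by rewrite fct_sumE.
have dvb (f : E -> R) : differentiable f u -> derivable f u (X u).
  exact: diff_derivable.
have dYG i j : derivable ((fun u' => Y u' 0 i) * (fun u' => G u' i j)) u (X u).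
  exact: (derivableM (dvb _ (dYc i)) (dvb _ (dGc i j))).
have alg (y q z d1 d2 d3 : R) : (y * q) * d1 + z * (y * d2 + q * d3)
    = d3 * q * z + y * q * d1 + y * z * d2 by ring.
rewrite derive_sum; last first.
  move=> i; apply: derivable_sum => j.
  exact: (derivableM (dYG i j) (dvb _ (dZc j))).
have -> : \sum_i 'D_(X u) (\sum_j ((fun u' => Y u' 0 i)
      * (fun u' => G u' i j) * (fun u' => Z u' 0 j))) u
  = \sum_i \sum_j ('D_(X u) Y u 0 i * G u i j * Z u 0 j
      + Y u 0 i * G u i j * 'D_(X u) Z u 0 j
      + Y u 0 i * Z u 0 j
        * \sum_l X u 0 l * 'D_('e_l) (fun u' => G u' i j) u).
  apply: eq_bigr => i _; rewrite derive_sum; last first.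
    by move=> j; exact: (derivableM (dYG i j) (dvb _ (dZc j))).
  apply: eq_bigr => j _.
  rewrite (deriveM (dYG i j) (dvb _ (dZc j))).
  rewrite (deriveM (dvb _ (dYc i)) (dvb _ (dGc i j))).
  rewrite DG DY DZ; exact: alg.
pose c (V : E) k := \sum_l \sum_m X u 0 l * V 0 m * christoffel G u k l m.
have nablaE V k : nabla G X V u 0 k = 'D_(X u) V u 0 k + c (V u) k.
  by rewrite !mxE.
rewrite /inner !bilinE.
have -> : \sum_i \sum_j nabla G X Y u 0 i * G u i j * Z u 0 j
  = \sum_i \sum_j 'D_(X u) Y u 0 i * G u i j * Z u 0 j
    + \sum_i \sum_j c (Y u) i * G u i j * Z u 0 j.
  rewrite -big_split; apply: eq_bigr => i _; rewrite -big_split.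
  by apply: eq_bigr => j _; rewrite nablaE /=; ring.
have -> : \sum_i \sum_j Y u 0 i * G u i j * nabla G X Z u 0 j
  = \sum_i \sum_j Y u 0 i * G u i j * 'D_(X u) Z u 0 j
    + \sum_i \sum_j Y u 0 i * G u i j * c (Z u) j.
  rewrite -big_split; apply: eq_bigr => i _; rewrite -big_split.
  by apply: eq_bigr => j _; rewrite nablaE /=; ring.
have cG V m : \sum_k c V k * G u k m = \sum_l \sum_i X u 0 l * V 0 i *
    (2^-1 * ('D_('e_l) (fun u' => G u' i m) u
      + 'D_('e_i) (fun u' => G u' l m) u - 'D_('e_m) (fun u' => G u' l i) u)).
  under eq_bigr do rewrite mulr_suml; rewrite exchange_big.
  apply: eq_bigr => l _; under eq_bigr do rewrite mulr_suml.
  rewrite exchange_big; apply: eq_bigr => i _.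
  rewrite -christoffel_lower // mulr_sumr; apply: eq_bigr => k _; ring.
have Gsym i j : G u i j = G u j i by rewrite -[in LHS]Gsu mxE.
have -> : \sum_i \sum_j c (Y u) i * G u i j * Z u 0 j
  = \sum_i \sum_j \sum_l Y u 0 i * Z u 0 j * X u 0 l *
    (2^-1 * ('D_('e_l) (fun u' => G u' i j) u
      + 'D_('e_i) (fun u' => G u' l j) u - 'D_('e_j) (fun u' => G u' l i) u)).
  rewrite exchange_big; under eq_bigr do rewrite -mulr_suml cG.
  rewrite [RHS]exchange_big; apply: eq_bigr => j _.
  rewrite [RHS]exchange_big mulr_suml; apply: eq_bigr => l _.
  by rewrite mulr_suml; apply: eq_bigr => i _; ring.
have -> : \sum_i \sum_j Y u 0 i * G u i j * c (Z u) j
  = \sum_i \sum_j \sum_l Y u 0 i * Z u 0 j * X u 0 l *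
    (2^-1 * ('D_('e_l) (fun u' => G u' j i) u
      + 'D_('e_j) (fun u' => G u' l i) u - 'D_('e_i) (fun u' => G u' l j) u)).
  apply: eq_bigr => i _; under eq_bigr do rewrite -mulrA Gsym [_ * c _ _]mulrC.
  rewrite -mulr_sumr cG exchange_big mulr_sumr; apply: eq_bigr => j _.
  by rewrite mulr_sumr; apply: eq_bigr => l _; ring.
rewrite addrACA -!big_split; apply: eq_bigr => i _.
rewrite /= -!big_split; apply: eq_bigr => j _ /=.
rewrite -big_split /= mulr_sumr; congr (_ + _); apply: eq_bigr => l _.
by rewrite (dGs l i j); field.
Unshelve. all: by end_near. Qed.

End LocalGeometry.

Definition smooth_local_field (R : realType) (n : nat) (M : manifold R n)
    (i : mindex M) (X : 'rV[R]_n -> 'rV[R]_n) : Prop :=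
  smooth_on (crange (mchart i)) X.

(* Einstein's equations k T = S + (lambda - r/2) g with
   T = p g + (sigma + p) eta (x) eta and eta(X) = g(X, xi). *)
Record perfect_fluid (R : realType) (M : manifold R 4) (g : lorentz_metric M)
    (xi : vector_field M) (p sigma : M -> R) (lambda k : R) : Prop :=
  PerfectFluid {
  pressure_smooth : smooth_function p;
  density_smooth : smooth_function sigma;
  velocity_unit : forall i u, crange (mchart i) u ->
    inner (g i) (xi i) (xi i) u = -1;
  einstein : forall i X Y u,
    smooth_local_field i X -> smooth_local_field i Y ->
    crange (mchart i) u ->
    let x := cinv (mchart i) u in
    let eta Z := inner (g i) Z (xi i) u in
    k * (p x * inner (g i) X Y u + (sigma x + p x) * (eta X * eta Y))
    = ricci (g i) X Y u
      + (lambda - scalar_curvature (g i) u / 2) * inner (g i) X Y u }.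

Definition eta_ricci_soliton (R : realType) (n : nat) (M : manifold R n)
    (g : lorentz_metric M) (xi : vector_field M) (a b : R) : Prop :=
  forall i X Y u,
    smooth_local_field i X -> smooth_local_field i Y ->
    crange (mchart i) u ->
    let eta Z := inner (g i) Z (xi i) u in
    lie_metric (g i) (xi i) X Y u + 2 * ricci (g i) X Y u
    + 2 * a * inner (g i) X Y u + 2 * b * (eta X * eta Y) = 0.

(* Main.v *)
(** Every tensor is evaluated at one point of one chart.  The g-trace of
    Einstein's equations gives S = A g + B eta (x) eta with
    A = lambda + k (sigma - p) / 2 and B = k (sigma + p).  Put into the soliton
    equation, this reads L_xi g + 2 (A + a) g + 2 (B + b) eta (x) eta = 0.
    As g(xi, xi) = -1 is constant, L_xi g (xi, xi) = 0, so the value of this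
    equation at (xi, xi) gives A + a = B + b; as L_xi g is twice the symmetric
    part of nabla xi, its g-trace gives div xi + 4 (A + a) - (B + b) = 0. *)
Require Import Defs.
From mathcomp Require Import all_boot all_order all_algebra.
From mathcomp Require Import all_classical all_reals all_analysis.
From mathcomp Require Import ring lra.
Import Order.TTheory GRing.Theory Num.Theory.
Import numFieldNormedType.Exports.
Local Open Scope ring_scope.

Section MetricTrace.
Context {R : realType} {n : nat}.
Implicit Types (B A N : 'M[R]_n) (v w : 'rV[R]_n).

(** Contraction of a covariant 2-tensor with the inverse metric. [T] is a function of indices, so
    that values on coordinate fields can be substituted directly. *)
Definition metric_trace B (T : 'I_n -> 'I_n -> R) : R :=
  \sum_i \sum_j invmx B i j * T i j.

Lemma metric_traceD B T1 T2 :
  metric_trace B (fun i j => T1 i j + T2 i j)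
  = metric_trace B T1 + metric_trace B T2.
Proof.
rewrite /metric_trace -big_split; apply: eq_bigr => i _ /=.
by rewrite -big_split; apply: eq_bigr => j _ /=; rewrite mulrDr.
Qed.

Lemma metric_traceZ B c T :
  metric_trace B (fun i j => c * T i j) = c * metric_trace B T.
Proof.
rewrite /metric_trace mulr_sumr; apply: eq_bigr => i _.
by rewrite mulr_sumr; apply: eq_bigr => j _; rewrite mulrCA.
Qed.

Lemma eq_metric_trace B T1 T2 :
  (forall i j, T1 i j = T2 i j) -> metric_trace B T1 = metric_trace B T2.
Proof. by move=> eqT; do 2![apply: eq_bigr => ? _]; rewrite eqT. Qed.

Lemma bilin_sym B v w : B^T = B -> bilin B v w = bilin B w v.
Proof.
move=> Bs; transitivity ((v *m B *m w^T)^T 0 0); first by rewrite [RHS]mxE.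
by rewrite !trmx_mul trmxK Bs mulmxA.
Qed.

Lemma bilin_deltar B v j : bilin B v 'e_j = (v *m B) 0 j.
Proof. by rewrite /bilin trmx_delta -colE mxE. Qed.

Lemma bilin_delta B i j : bilin B 'e_i 'e_j = B i j.
Proof. by rewrite bilin_deltar -rowE mxE. Qed.

Lemma bilinDl B v1 v2 w : bilin B (v1 + v2) w = bilin B v1 w + bilin B v2 w.
Proof. by rewrite /bilin !mulmxDl mxE. Qed.

Lemma bilinDr B v w1 w2 : bilin B v (w1 + w2) = bilin B v w1 + bilin B v w2.
Proof. by rewrite /bilin linearD mulmxDr mxE. Qed.

Section Symmetric.
Variable B : 'M[R]_n.
Hypotheses (Bs : B^T = B) (Bu : B \in unitmx).

Lemma invmx_sym i j : invmx B i j = invmx B j i.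
Proof. by rewrite -[in LHS]Bs -trmx_inv mxE. Qed.

Lemma metric_trace_mxtrace A : metric_trace B A = \tr (A *m invmx B).
Proof.
apply: eq_bigr => i _; rewrite mxE; apply: eq_bigr => j _.
by rewrite mulrC invmx_sym.
Qed.

Lemma metric_trace_self : metric_trace B B = n%:R.
Proof. by rewrite metric_trace_mxtrace mulmxV // mxtrace1. Qed.

(** The form dual to [w] has components [w *m B]; cyclicity of the trace cancels [B] against
    [invmx B]. *)
Lemma metric_trace_sqr w :
  metric_trace B (fun i j => bilin B 'e_i w * bilin B 'e_j w) = bilin B w w.
Proof.
transitivity (metric_trace B ((w *m B)^T *m (w *m B))).
  apply: eq_metric_trace => i j.
  by rewrite !(bilin_sym B _ w Bs) !bilin_deltar [RHS]mxE big_ord1 [_^T i 0]mxE.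
rewrite metric_trace_mxtrace -!mulmxA mulmxV // mulmx1 mxtrace_mulC.
by rewrite trmx_mul Bs mulmxA /mxtrace big_ord1.
Qed.

(** Lowering an index with [B] and raising it again with [invmx B] gives back the matrix of [f]. *)
Lemma metric_trace_lin1_mx (f : 'rV[R]_n -> 'rV[R]_n) :
  metric_trace B (fun i j => bilin B (f 'e_i) 'e_j) = \tr (lin1_mx f).
Proof.
transitivity (metric_trace B (lin1_mx f *m B)).
  apply: eq_metric_trace => i j; rewrite bilin_deltar !mxE.
  by apply: eq_bigr => l _; rewrite !mxE.
by rewrite metric_trace_mxtrace mulmxK.
Qed.

Lemma metric_trace_lin1_mxr (f : 'rV[R]_n -> 'rV[R]_n) :
  metric_trace B (fun i j => bilin B 'e_i (f 'e_j)) = \tr (lin1_mx f).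
Proof.
rewrite -metric_trace_lin1_mx /metric_trace exchange_big.
apply: eq_bigr => i _; apply: eq_bigr => j _.
by rewrite bilin_sym // invmx_sym.
Qed.

End Symmetric.
End MetricTrace.

Lemma lorentzian_unitmx (R : realType) (n : nat) (B : 'M[R]_n) :
  lorentzian B -> B \in unitmx.
Proof.
case=> _ [P Pu eqB]; have : Defs.minkowski R n \in unitmx.
  rewrite unitmxE det_diag unitfE; apply/prodf_neq0 => i _; rewrite mxE.
  by case: ifP => _; rewrite ?oppr_eq0 oner_eq0.
by rewrite -eqB !unitmx_mul => /andP[/andP[]].
Qed.

(** Makes the coordinate fields [cst 'e_j] admissible in Einstein's equations and in the soliton
    equation. *)
Lemma smooth_on_cst (R : realType) (n : nat) (W : normedModType R)
    (U : set 'rV[R]_n) (c : W) : smooth_on U (cst c).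
Proof.
move=> k; elim: k c => [|k IHk] c /=; first by move=> u _; exact: cst_continuous.
split=> [u _|v]; first exact: differentiable_cst.
rewrite (_ : (fun _ => _) = cst 0) //; apply/funext => u; exact: derive_cst.
Qed.

Section LieMetric.
Context {R : realType} {n : nat}.
Local Notation E := 'rV[R]_n.
Implicit Types (G : E -> 'M[R]_n) (X Y xi : E -> E) (u : E).

(** Metric compatibility expands the derivative of g(X, Y) along xi; by torsion-freeness,
    subtracting [xi, Z] from nabla_xi Z leaves nabla_Z xi. *)
Lemma lie_metric_nabla G xi X Y u :
  (\forall u' \near u, (G u')^T = G u') -> G u \in unitmx ->
  differentiable G u -> differentiable X u -> differentiable Y u ->
  lie_metric G xi X Y u
  = inner G (nabla G X xi) Y u + inner G X (nabla G Y xi) u.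
Proof.
move=> Gs Gu dG dX dY; rewrite /lie_metric nabla_metric // /inner.
have nablaE Z : nabla G xi Z u = nabla G Z xi u + bracket xi Z u.
  by rewrite -(nabla_torsion_free xi Z Gs) addrC subrK.
by rewrite !nablaE bilinDl bilinDr; ring.
Qed.

Lemma lie_metric_self G xi u (c : R) :
  (\forall u' \near u, inner G xi xi u' = c) -> lie_metric G xi xi xi u = 0.
Proof.
move=> near_c; rewrite /lie_metric (near_eq_derive (g := cst c)) //.
rewrite derive_cst /inner /bracket subrr.
by rewrite /bilin trmx0 mulmx0 !mul0mx mxE !subr0.
Qed.

Lemma metric_trace_lie_metric G xi u :
  (\forall u' \near u, (G u')^T = G u') -> G u \in unitmx ->
  differentiable G u ->
  metric_trace (G u) (fun i j => lie_metric G xi (cst 'e_i) (cst 'e_j) u)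
  = 2 * divergence G xi u.
Proof.
move=> Gs Gu dG; have Gsu := nbhs_singleton Gs.
under eq_metric_trace => i j do rewrite lie_metric_nabla //.
rewrite metric_traceD mulr2n mulrDl mul1r.
pose f v := nabla G (cst v) xi u.
congr (_ + _); first exact: (metric_trace_lin1_mx _ Gsu Gu f).
exact: (metric_trace_lin1_mxr _ Gsu Gu f).
Qed.

End LieMetric.

Theorem mainTheorem6 (R : realType) (M : manifold R 4) (g : lorentz_metric M)
    (xi : vector_field M) (p sigma : M -> R) (lambda k a b : R) :
  perfect_fluid g xi p sigma lambda k ->
  eta_ricci_soliton g xi a b ->
  forall (x : M) (i : mindex M), cdom (mchart i) x ->
    let div_xi := divergence (g i) (xi i) (cmap (mchart i) x) in
    a = - lambda - k * (sigma x - p x) / 2 - div_xi / 3 /\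
    b = - k * (sigma x + p x) - div_xi / 3.
Proof.
move=> fluid soliton x i xi_dom div_xi.
set u := cmap (mchart i) x in div_xi *.
have [_ open_range cmapK _ _] := manifold_chart i.
have ru : crange (mchart i) u by exists x.
(* Identities valid on the whole chart range hold near [u], hence may be differentiated there. *)
have near_range : \forall u' \near u, crange (mchart i) u'.
  by apply: open_nbhs_nbhs.
have Gs : \forall u' \near u, (g i u')^T = g i u'.
  by apply: filterS near_range => u' /(metric_lorentzian g)[].
have Gsu := nbhs_singleton Gs.
have Gu : g i u \in unitmx by exact: lorentzian_unitmx (metric_lorentzian g ru).
have dG : differentiable (g i) u.
  by have [dG _] := @metric_smooth _ _ _ g i 1%N; exact: dG.
have xi_smooth : smooth_local_field i (xi i) by exact: vector_field_smooth.
have e_smooth j : smooth_local_field i (cst 'e_j) by exact: smooth_on_cst.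
have unit_xi : bilin (g i u) (xi i u) (xi i u) = -1.
  exact: velocity_unit fluid _ _ ru.
have ricciE X Y : smooth_local_field i X -> smooth_local_field i Y ->
    ricci (g i) X Y u = (k * p x - lambda + scalar_curvature (g i) u / 2)
        * inner (g i) X Y u
      + k * (sigma x + p x)
        * (inner (g i) X (xi i) u * inner (g i) Y (xi i) u).
  move=> sX sY; have /= := einstein fluid sX sY ru; rewrite cmapK // => eqE; lra.
set r := scalar_curvature (g i) u in ricciE *.
(* The g-trace of [ricciE], with tr g = 4 and tr (eta (x) eta) = -1; it determines r = 4 lambda + k
   (sigma - 3 p). *)
have rE : r = (k * p x - lambda + r / 2) * 4 - k * (sigma x + p x).
  rewrite [LHS](_ : _ = metric_trace (g i u)
    (fun j l => ricci (g i) (cst 'e_j) (cst 'e_l) u)) //.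
  under eq_metric_trace => j l do
    rewrite ricciE // /inner /= bilin_delta.
  rewrite metric_traceD !metric_traceZ metric_trace_self //.
  by rewrite metric_trace_sqr // unit_xi mulrN1.
have solE X Y (sX : smooth_local_field i X) (sY : smooth_local_field i Y) :=
  soliton i X Y u sX sY ru.
have := solE _ _ xi_smooth xi_smooth.
rewrite /= ricciE // (@lie_metric_self _ _ _ _ _ (-1)); last first.
  by apply: filterS near_range => u'; exact: velocity_unit fluid _ _.
rewrite /inner unit_xi => sol_xi.
have sol_trace : 2 * div_xi + 2 * r + 2 * a * 4 + 2 * b * -1 = 0.
  (* Each summand is rewritten as a metric trace; the single trace they form vanishes term by term
     by the soliton equation. *)
  rewrite -unit_xi -metric_trace_sqr // -(metric_trace_self (g i u)) //.
  rewrite -metric_trace_lie_metric // -!metric_traceZ -!metric_traceD.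
  rewrite /metric_trace big1 // => j _; rewrite big1 // => l _.
  have /= := solE _ _ (e_smooth j) (e_smooth l).
  by rewrite /inner /= bilin_delta => ->; rewrite mulr0.
(* With r eliminated, [sol_xi] and [sol_trace] form a linear system: A + a = B + b = - div xi /
   3. *)
by split; lra.
Qed.
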